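(* Let $0<|q|<1$ and let $a,s,t$ be complex numbers with $s,t\neq 0$ and $\left|\frac{1}{st}\right|<1$, such that no denominator below vanishes. Then \[ \sum_{n=0}^{\infty}\frac{(a^2,aq^2,-aq^2;q^2)_n\,(s,t;q)_n}{(q^2,a,-a;q^2)_n\,(aq/s,aq/t;q)_n}\left(-\frac{1}{st}\right)^n =\frac{s+t}{st}\,\frac{(aq,-q/s,-q/t,aq/(st);q)_\infty}{(-q,aq/s,aq/t,-1/(st);q)_\infty}. \]
   Context: For $0<|q|<1$: $(x;q)_\infty=\prod_{i=0}^{\infty}(1-xq^i)$ and $(x;q)_n=(x;q)_\infty/(xq^n;q)_\infty$ for any integer $n$. Also $(x_1,\dots,x_r;q)_k=(x_1;q)_k\cdots(x_r;q)_k$ for $k$ an integer or $\infty$. *)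

(* Defs.v *)
From Stdlib Require Export Reals List.
From Stdlib Require Import Lra Lia.
From Coquelicot Require Export Coquelicot.
Export ListNotations.

Open Scope R_scope.
Open Scope C_scope.

(* For n >= 0 the quotient (x;q)_oo / (x q^n;q)_oo is read as the finite product
   it reduces to, so that it also makes sense when (x q^n;q)_oo = 0, i.e. for
   x = q^(-k) with k >= n; see [qpoch_ratio]. *)
Fixpoint qpoch (x q : C) (n : nat) : C :=
  match n with
  | O => 1
  | S m => qpoch x q m * (1 - x * q ^ m)
  end.

(* [iota] picks the unique limit; existence for |q| < 1 is [qpoch_inf_correct]. *)
Definition qpoch_inf (x q : C) : C :=
  iota (T := C_CompleteNormedModule)
    (fun l : C => filterlim (qpoch x q) eventually (locally l)).

Definition qpochs (xs : list C) (q : C) (n : nat) : C :=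
  fold_right (fun x p => qpoch x q n * p) (RtoC 1) xs.

Definition qpochs_inf (xs : list C) (q : C) : C :=
  fold_right (fun x p => qpoch_inf x q * p) (RtoC 1) xs.

Lemma qpoch_bound (x q : C) (n : nat) : (Cmod q < 1)%R ->
  (Cmod (qpoch x q n) <= exp (Cmod x * ((1 - Cmod q ^ n) / (1 - Cmod q))))%R.
Proof.
intros hq. induction n as [|n IH].
- simpl. rewrite Cmod_1.
  replace (Cmod x * ((1 - 1) / (1 - Cmod q)))%R with 0%R by (field; lra).
  rewrite exp_0. lra.
- simpl qpoch. rewrite Cmod_mult.
  replace (Cmod x * ((1 - Cmod q ^ S n) / (1 - Cmod q)))%R
    with (Cmod x * ((1 - Cmod q ^ n) / (1 - Cmod q)) + Cmod x * Cmod q ^ n)%R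
    by (simpl; field; lra).
  rewrite exp_plus.
  apply Rmult_le_compat; try apply Cmod_ge_0; [exact IH|].
  apply Rle_trans with (1 + Cmod x * Cmod q ^ n)%R.
  + unfold Cminus. eapply Rle_trans; [apply Cmod_triangle|].
    rewrite Cmod_1, Cmod_opp, Cmod_mult, Cmod_pow. lra.
  + apply exp_ineq1_le.
Qed.

Lemma ex_qpoch_inf (x q : C) : (Cmod q < 1)%R ->
  exists l : C, filterlim (qpoch x q) eventually (locally l).
Proof.
intros hq.
pose (M := exp (Cmod x * / (1 - Cmod q))).
pose (d := fun n => - (x * q ^ n * qpoch x q n)).
assert (hd : @ex_series C_AbsRing C_NormedModule d).
{ apply (@ex_series_le C_AbsRing C_CompleteNormedModule)
    with (b := fun n => (Cmod x * M * Cmod q ^ n)%R).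
  - intro n. change (Cmod (d n) <= Cmod x * M * Cmod q ^ n)%R.
    unfold d. rewrite Cmod_opp, !Cmod_mult, Cmod_pow.
    assert (h0 := Cmod_ge_0 x).
    assert (h1 := pow_le (Cmod q) n (Cmod_ge_0 q)).
    assert (h2 : (Cmod (qpoch x q n) <= M)%R).
    { eapply Rle_trans; [apply qpoch_bound; exact hq|].
      unfold M.
      destruct (Rle_lt_or_eq_dec (Cmod x * ((1 - Cmod q ^ n) / (1 - Cmod q)))
                  (Cmod x * / (1 - Cmod q))) as [h|h].
      - apply Rmult_le_compat_l; [exact h0|].
        unfold Rdiv. rewrite <- (Rmult_1_l (/ (1 - Cmod q))) at 2.
        apply Rmult_le_compat_r; [|lra].
        left; apply Rinv_0_lt_compat; lra.
      - left; now apply exp_increasing.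
      - rewrite h; lra. }
    replace (Cmod x * M * Cmod q ^ n)%R with (Cmod x * Cmod q ^ n * M)%R by ring.
    apply Rmult_le_compat_l; [|exact h2].
    now apply Rmult_le_pos.
  - apply (ex_series_scal (K := R_AbsRing) (V := R_NormedModule)).
    apply ex_series_geom. rewrite Rabs_pos_eq; [exact hq|apply Cmod_ge_0]. }
destruct hd as [l hl].
exists (1 + l).
assert (hsum : forall n, qpoch x q (S n) = 1 + @sum_n C_AbelianMonoid d n).
{ induction n as [|n IH].
  - rewrite sum_O. unfold d. simpl. ring.
  - rewrite sum_Sn. change (qpoch x q (S n) * (1 - x * q ^ S n)
      = 1 + (@sum_n C_AbelianMonoid d n + d (S n))).
    rewrite Cplus_assoc, <- IH. unfold d. ring. }
assert (h : filterlim (fun n => 1 + @sum_n C_AbelianMonoid d n) eventually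
          (locally (1 + l))).
{ apply (filterlim_comp_2 (G := locally (RtoC 1)) (H := locally l)
    (F := eventually) (fun _ => RtoC 1) (@sum_n C_AbelianMonoid d) Cplus).
  - apply filterlim_const.
  - exact hl.
  - apply (@filterlim_plus C_AbsRing C_NormedModule). }
intros P hP. destruct (h P hP) as [N hN].
exists (S N). intros [|n] hn; [lia|].
rewrite hsum. apply hN. lia.
Qed.

Lemma qpoch_inf_unique (x q l : C) :
  filterlim (qpoch x q) eventually (locally l) -> qpoch_inf x q = l.
Proof.
intro h. exact (iota_filterlim_locally (V := C_CompleteNormedModule) _ _ h).
Qed.

Lemma qpoch_inf_correct (x q : C) : (Cmod q < 1)%R ->
  filterlim (qpoch x q) eventually (locally (qpoch_inf x q)).
Proof.
intro hq. destruct (ex_qpoch_inf x q hq) as [l hl].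
now rewrite (qpoch_inf_unique _ _ _ hl).
Qed.

Lemma qpoch_add (x q : C) (n m : nat) :
  qpoch x q (n + m) = qpoch x q n * qpoch (x * q ^ n) q m.
Proof.
induction m as [|m IH].
- rewrite Nat.add_0_r. simpl. ring.
- rewrite Nat.add_succ_r. simpl. rewrite IH, Cpow_add_r. ring.
Qed.

Lemma qpoch_ratio (x q : C) (n : nat) : (Cmod q < 1)%R ->
  qpoch_inf (x * q ^ n) q <> 0 ->
  qpoch x q n = qpoch_inf x q / qpoch_inf (x * q ^ n) q.
Proof.
intros hq h0.
assert (e : qpoch_inf x q = qpoch x q n * qpoch_inf (x * q ^ n) q).
{ apply qpoch_inf_unique.
  assert (h : filterlim (fun m => qpoch x q n * qpoch (x * q ^ n) q m) eventually
            (locally (qpoch x q n * qpoch_inf (x * q ^ n) q))).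
  { apply (filterlim_comp _ _ _ _ (fun z => qpoch x q n * z) _ _ _
      (qpoch_inf_correct (x * q ^ n) q hq)).
    apply (@filterlim_scal_r C_AbsRing C_NormedModule). }
  intros P hP. destruct (h P hP) as [N hN].
  exists (n + N)%nat. intros m hm.
  replace m with (n + (m - n))%nat by lia.
  rewrite qpoch_add. apply hN. lia. }
rewrite e. field. exact h0.
Qed.

(* Main.v *)
Require Import Defs.
From Stdlib Require Import Lra Lia.
Open Scope C_scope.

(** Put [x = q^n] and [w = -1/(st)]. Up to a constant, the summand is that of a
    very-well-poised 6phi5 series with [b = -a], multiplied by [1 + a x^2] and with the
    power [w^n] in place of [(wq)^n = x w^n]. The identity
    [1 + a x^2 = (1 + a) x + (1 - x)(1 - a x)] therefore splits the series into
    two 6phi5 series, with parameters [(a; -a, s, t)] and, since the factor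
    [(1 - x)(1 - a x)] shifts the index, [(a q^2; -a q, s q, t q)].
    The nonterminating 6phi5 sum itself follows from a WZ-type first-order
    recurrence in [a -> a q] (with [aq/b -> (aq/b) q], and [c, d] fixed), iterated until
    only the constant term of the series survives. *)

(** * Complex limits and series *)

Local Notation Clim u l := (filterlim u eventually (locally (l : C))).
Local Notation is_Cseries := (@is_series C_AbsRing C_NormedModule).

Lemma Clim_unique (u : nat -> C) (l l' : C) : Clim u l -> Clim u l' -> l = l'.
Proof.
apply (@filterlim_locally_unique nat C_AbsRing C_NormedModule eventually _ u l l').
Qed.

Lemma Clim_mult (u v : nat -> C) (lu lv : C) :
  Clim u lu -> Clim v lv -> Clim (fun n => u n * v n) (lu * lv).
Proof.
intros lim_u lim_v P nbhd_P. apply locally_C in nbhd_P. revert P nbhd_P.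
apply (filterlim_comp_2 (F := eventually)
  (G := locally (T := AbsRing_UniformSpace C_AbsRing) lu)
  (H := locally (T := AbsRing_UniformSpace C_AbsRing) lv) u v Cmult).
- intros P nbhd_P; apply lim_u, locally_C, nbhd_P.
- intros P nbhd_P; apply lim_v, locally_C, nbhd_P.
- apply (@filterlim_mult C_AbsRing).
Qed.

Lemma Clim_iff_Cmod_minus (u : nat -> C) (l : C) :
  Clim u l <-> is_lim_seq (fun n => Cmod (u n - l)) 0.
Proof.
rewrite (@filterlim_locally_ball_norm C_AbsRing nat C_NormedModule eventually _ u l).
rewrite <- is_lim_seq_spec. simpl.
split; intros near eps; destruct (near eps) as [N near_N];
  exists N; intros n le_N_n; specialize (near_N n le_N_n).
- rewrite Rminus_0_r, Rabs_pos_eq by apply Cmod_ge_0. exact near_N.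
- rewrite Rminus_0_r, Rabs_pos_eq in near_N by apply Cmod_ge_0. exact near_N.
Qed.

Lemma filterlim_eventually_incr_1 {T : Type} (u : nat -> T) (F : (T -> Prop) -> Prop) :
  filterlim u eventually F -> filterlim (fun n => u (S n)) eventually F.
Proof.
intro lim_u. apply (filterlim_comp _ _ _ S u eventually eventually); [|exact lim_u].
apply eventually_subseq. intro n. lia.
Qed.

Definition Cseries (u : nat -> C) : C :=
  iota (T := C_CompleteNormedModule) (is_Cseries u).

Lemma Cseries_correct (u : nat -> C) :
  @ex_series C_AbsRing C_NormedModule u -> is_Cseries u (Cseries u).
Proof.
intros [l sum_l]. replace (Cseries u) with l; [exact sum_l|].
symmetry. exact (iota_filterlim_locally (V := C_CompleteNormedModule) _ l sum_l).
Qed.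

Lemma is_series_telescope {K : AbsRing} {V : NormedModule K} (u : nat -> V) (l : V) :
  filterlim u eventually (locally l) ->
  is_series (fun n => minus (u (S n)) (u n)) (minus l (u O)).
Proof.
intro lim_u.
apply (filterlim_ext (fun n => minus (u (S n)) (u O))).
- intro n. induction n as [|n IH].
  + now rewrite sum_O.
  + rewrite sum_Sn, <- IH, plus_comm. apply (minus_trans (u (S n))).
- apply (filterlim_comp_2 (G := locally l) (H := locally (opp (u O)))
    (fun n => u (S n)) (fun _ => opp (u O)) plus).
  + now apply filterlim_eventually_incr_1.
  + apply filterlim_const.
  + apply filterlim_plus.
Qed.

Lemma norm_is_series_le {K : AbsRing} {V : NormedModule K}
  (u : nat -> V) (b : nat -> R) (l : V) (s : R) :
  (forall n, (norm (u n) <= b n)%R) -> is_series u l -> is_series b s ->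
  (norm l <= s)%R.
Proof.
intros le_b sum_u sum_b.
apply (is_lim_seq_le (fun n => norm (sum_n u n)) (sum_n b) (norm l) s).
- intro n. eapply Rle_trans; [apply norm_sum_n_m|]. now apply sum_n_m_le.
- apply (filterlim_comp _ _ _ (sum_n u) norm _ (locally l)); [exact sum_u|].
  apply filterlim_norm.
- exact sum_b.
Qed.

Lemma pow_unit_interval (r : R) (n : nat) : (0 <= r <= 1)%R -> (0 <= r ^ n <= 1)%R.
Proof.
intro r_range. split; [now apply pow_le|]. rewrite <- (pow1 n). now apply pow_incr.
Qed.

Lemma geom_partial_sum_bounds (r : R) (n : nat) : (0 <= r < 1)%R ->
  (0 <= (1 - r ^ n) / (1 - r) <= / (1 - r))%R.
Proof.
intro r_range. assert (r_n := pow_unit_interval r n ltac:(lra)). split.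
- apply Rdiv_le_0_compat; lra.
- rewrite <- (Rmult_1_l (/ (1 - r))).
  apply Rmult_le_compat_r; [left; apply Rinv_0_lt_compat|]; lra.
Qed.

Lemma is_series_scal_geom (K r : R) : (0 <= r < 1)%R ->
  is_series (fun n => (K * r ^ n)%R) (K / (1 - r))%R.
Proof.
intro r_range.
apply (is_series_scal (K := R_AbsRing) (V := R_NormedModule) K (fun n => r ^ n)%R).
apply is_series_geom. rewrite Rabs_pos_eq; lra.
Qed.

Lemma is_lim_seq_scal_geom (K r : R) : (0 <= r < 1)%R ->
  is_lim_seq (fun n => K * r ^ n)%R 0.
Proof.
intro r_range. replace (Finite 0) with (Rbar_mult K 0) by (simpl; f_equal; ring).
apply is_lim_seq_scal_l, is_lim_seq_geom. rewrite Rabs_pos_eq; lra.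
Qed.

(* A special case of Tannery's theorem. *)
Lemma Clim_series_head (u : nat -> nat -> C) (s : nat -> C) (l : C) (K r rho : R) :
  (0 <= r < 1)%R -> (0 <= rho < 1)%R ->
  (forall k n, (Cmod (u k n) <= K * (r * rho ^ k) ^ n)%R) ->
  (forall k, is_Cseries (u k) (s k)) ->
  Clim (fun k => u k O) l -> Clim s l.
Proof.
intros r_range rho_range bound_u sum_u lim_head.
assert (K_ge_0 : (0 <= K)%R).
{ generalize (bound_u O O) (Cmod_ge_0 (u O O)). simpl. lra. }
assert (tail_bound : forall k, (Cmod (s k - u k O) <= K / (1 - r) * rho ^ k)%R).
{ intro k.
  assert (rho_k := pow_unit_interval rho k ltac:(lra)).
  replace (K / (1 - r) * rho ^ k)%R with (K * rho ^ k / (1 - r))%R by (field; lra).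
  apply (@norm_is_series_le C_AbsRing C_NormedModule (fun n => u k (S n))
    (fun n => K * rho ^ k * r ^ n)%R).
  - intro n. eapply Rle_trans; [apply bound_u|].
    rewrite Rmult_assoc. apply Rmult_le_compat_l; [exact K_ge_0|].
    assert (ratio_le_r : (0 <= r * rho ^ k <= r)%R) by nra.
    apply Rmult_le_compat; [apply ratio_le_r|now apply pow_le| |now apply pow_incr].
    nra.
  - apply (@is_series_incr_1 C_AbsRing C_NormedModule).
    change (is_Cseries (u k) (s k - u k O + u k O)).
    replace (s k - u k O + u k O) with (s k) by ring. apply sum_u.
  - now apply is_series_scal_geom. }
apply Clim_iff_Cmod_minus.
apply (is_lim_seq_le_le (fun _ => 0%R) _
  (fun k => K / (1 - r) * rho ^ k + Cmod (u k O - l))%R).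
- intro k. split; [apply Cmod_ge_0|].
  replace (s k - l) with (s k - u k O + (u k O - l)) by ring.
  eapply Rle_trans; [apply Cmod_triangle|]. now apply Rplus_le_compat_r.
- apply is_lim_seq_const.
- replace 0%R with (0 + 0)%R by ring.
  apply is_lim_seq_plus'; [now apply is_lim_seq_scal_geom|].
  now apply Clim_iff_Cmod_minus.
Qed.

Definition Cbounded {I : Type} (u : I -> C) : Prop :=
  exists M : R, forall i, (Cmod (u i) <= M)%R.

Lemma Cbounded_mult {I : Type} (u v : I -> C) :
  Cbounded u -> Cbounded v -> Cbounded (fun i => u i * v i).
Proof.
intros [M bound_u] [N bound_v]. exists (M * N)%R. intro i. rewrite Cmod_mult.
apply Rmult_le_compat; auto using Cmod_ge_0.
Qed.

Lemma Cbounded_minus {I : Type} (u v : I -> C) :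
  Cbounded u -> Cbounded v -> Cbounded (fun i => u i - v i).
Proof.
intros [M bound_u] [N bound_v]. exists (M + N)%R. intro i.
eapply Rle_trans; [apply Cmod_triangle|]. rewrite Cmod_opp.
now apply Rplus_le_compat.
Qed.

Lemma Cbounded_const {I : Type} (x : C) : Cbounded (fun _ : I => x).
Proof. exists (Cmod x). intros _. lra. Qed.

Lemma Cbounded_pow {I : Type} (q : C) (n : I -> nat) : (Cmod q <= 1)%R ->
  Cbounded (fun i => q ^ n i).
Proof.
intro q_le_1. exists 1%R. intro i. rewrite Cmod_pow.
apply pow_unit_interval. split; [apply Cmod_ge_0|exact q_le_1].
Qed.

Lemma Clim_bounded_mul_pow (u : nat -> C) (z : C) :
  Cbounded u -> (Cmod z < 1)%R -> Clim (fun n => u n * z ^ n) 0.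
Proof.
intros [M bound_u] z_lt_1. apply Clim_iff_Cmod_minus.
apply (is_lim_seq_le_le (fun _ => 0%R) _ (fun n => M * Cmod z ^ n)%R).
- intro n. split; [apply Cmod_ge_0|].
  replace (u n * z ^ n - 0) with (u n * z ^ n) by ring.
  rewrite Cmod_mult, Cmod_pow.
  apply Rmult_le_compat_r; [apply pow_le, Cmod_ge_0|apply bound_u].
- apply is_lim_seq_const.
- apply is_lim_seq_scal_geom. split; [apply Cmod_ge_0|exact z_lt_1].
Qed.

(** * q-products without zero factors *)

Definition q_regular (q x : C) : Prop := forall n : nat, 1 - x * q ^ n <> 0.

Lemma q_regular_qpoch (q x : C) :
  q_regular q x <-> forall n, qpoch x q n <> 0.
Proof.
split.
- intros x_reg n. induction n as [|n IH]; [exact C1_nz|].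
  apply Cmult_neq_0; [exact IH|apply x_reg].
- intros qpoch_neq_0 n factor_0. apply (qpoch_neq_0 (S n)). simpl.
  rewrite factor_0. ring.
Qed.

Lemma q_regular_qpochs (q x : C) (xs : list C) :
  (forall n, qpochs xs q n <> 0) -> In x xs -> q_regular q x.
Proof.
induction xs as [|y xs IH]; [contradiction|].
intros neq_0 [-> |in_xs].
- apply q_regular_qpoch. intros n x_0. apply (neq_0 n). simpl. rewrite x_0. ring.
- apply IH; [|exact in_xs].
  intros n xs_0. apply (neq_0 n). simpl. rewrite xs_0. ring.
Qed.

Lemma q_regular_shift (q x : C) (k : nat) : q_regular q x -> q_regular q (x * q ^ k).
Proof.
intros x_reg n. rewrite <- Cmult_assoc, <- Cpow_add_r. apply x_reg.
Qed.

Lemma q_regular_shift_1 (q x : C) : q_regular q x -> q_regular q (x * q).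
Proof.
intro x_reg. rewrite <- (Cpow_1_r q) at 2. now apply q_regular_shift.
Qed.

Lemma q_regular_neq_1 (q x : C) : q_regular q x -> 1 - x <> 0.
Proof. intro x_reg. specialize (x_reg O). now rewrite Cmult_1_r in x_reg. Qed.

Lemma q_regular_small (q x : C) : (Cmod q < 1)%R -> (Cmod x < 1)%R -> q_regular q x.
Proof.
intros q_lt_1 x_lt_1 n factor_0.
assert (Cmod_1_eq : (Cmod x * Cmod q ^ n = 1)%R).
{ rewrite <- Cmod_pow, <- Cmod_mult, <- Cmod_1. f_equal.
  rewrite <- (Cplus_0_l (x * q ^ n)), <- factor_0. ring. }
generalize (pow_unit_interval (Cmod q) n (conj (Cmod_ge_0 q) (Rlt_le _ _ q_lt_1)))
  (Cmod_ge_0 x).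
nra.
Qed.

Lemma qpoch_succ_l (x q : C) (n : nat) :
  qpoch x q (S n) = (1 - x) * qpoch (x * q) q n.
Proof.
change (S n) with (1 + n)%nat. rewrite qpoch_add, Cpow_1_r. simpl. ring.
Qed.

Lemma qpoch_shift_1 (x q : C) (n : nat) : 1 - x <> 0 ->
  qpoch (x * q) q n = qpoch x q n * (1 - x * q ^ n) / (1 - x).
Proof.
intro x_neq_1. change (qpoch x q n * (1 - x * q ^ n)) with (qpoch x q (S n)).
rewrite qpoch_succ_l. field. exact x_neq_1.
Qed.

Lemma qpoch_inf_succ (x q : C) : (Cmod q < 1)%R ->
  qpoch_inf x q = (1 - x) * qpoch_inf (x * q) q.
Proof.
intro q_lt_1. apply (Clim_unique (fun n => qpoch x q (S n))).
- now apply filterlim_eventually_incr_1, qpoch_inf_correct.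
- eapply filterlim_ext; [intro n; symmetry; apply qpoch_succ_l|].
  apply (Clim_mult (fun _ => 1 - x)); [apply filterlim_const|].
  now apply qpoch_inf_correct.
Qed.

Lemma qpoch_inf_add (x q : C) (n : nat) : (Cmod q < 1)%R ->
  qpoch_inf x q = qpoch x q n * qpoch_inf (x * q ^ n) q.
Proof.
intro q_lt_1. induction n as [|n IH].
- simpl. rewrite Cmult_1_r. ring.
- rewrite IH, (qpoch_inf_succ (x * q ^ n)) by exact q_lt_1.
  rewrite Cpow_S. simpl. rewrite (Cmult_comm q), !Cmult_assoc. reflexivity.
Qed.

Lemma qpochs_inf_correct (xs : list C) (q : C) : (Cmod q < 1)%R ->
  Clim (qpochs xs q) (qpochs_inf xs q).
Proof.
intro q_lt_1. induction xs as [|x xs IH].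
- apply (filterlim_const (F := eventually) (U := C_UniformSpace) (RtoC 1)).
- apply (Clim_mult (qpoch x q) (qpochs xs q)); [|exact IH].
  now apply qpoch_inf_correct.
Qed.

(* Weierstrass' inequality [prod (1 - u_i) >= 1 - sum u_i]. *)
Lemma qpoch_lower_bound (x q : C) (n : nat) : (Cmod q < 1)%R ->
  (1 - Cmod x * ((1 - Cmod q ^ n) / (1 - Cmod q)) <= Cmod (qpoch x q n))%R.
Proof.
intro q_lt_1. induction n as [|n IH]; simpl qpoch.
- rewrite Cmod_1. simpl. right. field. lra.
- rewrite Cmod_mult.
  replace (Cmod x * ((1 - Cmod q ^ S n) / (1 - Cmod q)))%R
    with (Cmod x * ((1 - Cmod q ^ n) / (1 - Cmod q)) + Cmod (x * q ^ n))%R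
    by (rewrite Cmod_mult, Cmod_pow; simpl; field; lra).
  assert (factor_ge : (1 - Cmod (x * q ^ n) <= Cmod (1 - x * q ^ n))%R).
  { generalize (Cmod_triangle (1 - x * q ^ n) (x * q ^ n)).
    replace (1 - x * q ^ n + x * q ^ n) with (RtoC 1) by ring.
    rewrite Cmod_1. lra. }
  assert (sum_ge_0 : (0 <= Cmod x * ((1 - Cmod q ^ n) / (1 - Cmod q)))%R).
  { apply Rmult_le_pos; [apply Cmod_ge_0|].
    apply geom_partial_sum_bounds. split; [apply Cmod_ge_0|exact q_lt_1]. }
  set (partial := (Cmod x * ((1 - Cmod q ^ n) / (1 - Cmod q)))%R) in *.
  assert (new_ge_0 := Cmod_ge_0 (x * q ^ n)).
  destruct (Rle_lt_dec 1 (partial + Cmod (x * q ^ n))) as [sum_ge_1|sum_lt_1].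
  + apply Rle_trans with 0%R; [lra|]. apply Rmult_le_pos; apply Cmod_ge_0.
  + apply Rle_trans with ((1 - partial) * (1 - Cmod (x * q ^ n)))%R; [nra|].
    apply Rmult_le_compat; lra.
Qed.

Lemma qpoch_inf_neq_0_small (x q : C) : (Cmod q < 1)%R ->
  (Cmod x / (1 - Cmod q) < 1)%R -> qpoch_inf x q <> 0.
Proof.
intros q_lt_1 x_small inf_0.
assert (lim_0 := qpoch_inf_correct x q q_lt_1). rewrite inf_0 in lim_0.
apply Clim_iff_Cmod_minus in lim_0.
assert (bound_le_0 : (1 - Cmod x / (1 - Cmod q) <= 0)%R).
{ apply (is_lim_seq_le (fun _ => 1 - Cmod x / (1 - Cmod q))%R
    (fun n => Cmod (qpoch x q n - 0)) (1 - Cmod x / (1 - Cmod q))%R 0%R);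
    [|apply is_lim_seq_const|exact lim_0].
  intro n. replace (qpoch x q n - 0) with (qpoch x q n) by ring.
  eapply Rle_trans; [|now apply qpoch_lower_bound].
  apply Rplus_le_compat_l, Ropp_le_contravar, Rmult_le_compat_l;
    [apply Cmod_ge_0|].
  apply geom_partial_sum_bounds. split; [apply Cmod_ge_0|exact q_lt_1]. }
lra.
Qed.

Lemma qpoch_inf_neq_0 (x q : C) : (Cmod q < 1)%R -> q_regular q x ->
  qpoch_inf x q <> 0.
Proof.
intros q_lt_1 x_reg.
assert (lim_tail := is_lim_seq_scal_geom (Cmod x / (1 - Cmod q)) (Cmod q)
  (conj (Cmod_ge_0 q) q_lt_1)).
apply is_lim_seq_spec in lim_tail.
destruct (lim_tail (mkposreal 1 Rlt_0_1)) as [N tail_small].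
specialize (tail_small N (le_n N)). simpl in tail_small.
rewrite (qpoch_inf_add x q N q_lt_1).
apply Cmult_neq_0; [now apply q_regular_qpoch|].
apply qpoch_inf_neq_0_small; [exact q_lt_1|].
rewrite Cmod_mult, Cmod_pow.
replace (Cmod x * Cmod q ^ N / (1 - Cmod q))%R
  with (Cmod x / (1 - Cmod q) * Cmod q ^ N - 0)%R by (field; lra).
eapply Rle_lt_trans; [apply Rle_abs|exact tail_small].
Qed.

Lemma qpochs_inf_neq_0 (xs : list C) (q : C) : (Cmod q < 1)%R ->
  List.Forall (q_regular q) xs -> qpochs_inf xs q <> 0.
Proof.
intros q_lt_1 xs_reg. induction xs_reg as [|x xs x_reg _ IH]; [exact C1_nz|].
apply Cmult_neq_0; [now apply qpoch_inf_neq_0|exact IH].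
Qed.

Lemma Cbounded_qpoch {I : Type} (x : I -> C) (q : C) (n : I -> nat) :
  (Cmod q < 1)%R -> Cbounded x -> Cbounded (fun i => qpoch (x i) q (n i)).
Proof.
intros q_lt_1 [M bound_x]. exists (exp (M * / (1 - Cmod q)))%R. intro i.
eapply Rle_trans; [now apply qpoch_bound|].
assert (exponent_le :
  (Cmod (x i) * ((1 - Cmod q ^ n i) / (1 - Cmod q)) <= M * / (1 - Cmod q))%R).
{ assert (geom := geom_partial_sum_bounds (Cmod q) (n i)
    (conj (Cmod_ge_0 q) q_lt_1)).
  apply Rmult_le_compat; [apply Cmod_ge_0|apply geom|apply bound_x|apply geom]. }
destruct exponent_le as [exponent_lt| ->]; [|now right].
left. now apply exp_increasing.
Qed.

Lemma Cbounded_inv_qpoch {I : Type} (x q : C) (n : I -> nat) :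
  (Cmod q < 1)%R -> q_regular q x -> Cbounded (fun i => / qpoch x q (n i)).
Proof.
intros q_lt_1 x_reg.
assert (qpoch_neq_0 := proj1 (q_regular_qpoch q x) x_reg).
assert (inf_neq_0 := qpoch_inf_neq_0 x q q_lt_1 x_reg).
assert (lim_Cmod : is_lim_seq (fun m => Cmod (qpoch x q m)) (Cmod (qpoch_inf x q))).
{ apply (filterlim_comp _ _ _ (qpoch x q) Cmod _ (locally (qpoch_inf x q))).
  - now apply qpoch_inf_correct.
  - apply (@filterlim_norm C_AbsRing C_NormedModule). }
apply (is_lim_seq_inv _ _) in lim_Cmod.
- destruct (filterlim_bounded (K := R_AbsRing) (V := R_NormedModule)
    (fun m => / Cmod (qpoch x q m))%R) as [M bound_inv].
  + exists (/ Cmod (qpoch_inf x q))%R. exact lim_Cmod.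
  + exists M. intro i. rewrite Cmod_inv by apply qpoch_neq_0.
    eapply Rle_trans; [apply Rle_abs|apply bound_inv].
- intro Cmod_0. apply inf_neq_0, Cmod_eq_0. now injection Cmod_0.
Qed.

Lemma Cbounded_inv_qpoch_shift {I : Type} (x q : C) (k n : I -> nat) :
  (Cmod q < 1)%R -> q_regular q x ->
  Cbounded (fun i => / qpoch (x * q ^ k i) q (n i)).
Proof.
intros q_lt_1 x_reg.
destruct (Cbounded_mult (fun i => qpoch x q (k i))
  (fun i => / qpoch x q (k i + n i))) as [M bound_ratio].
- apply Cbounded_qpoch; [exact q_lt_1|apply Cbounded_const].
- now apply Cbounded_inv_qpoch.
- exists M. intro i.
  replace (/ qpoch (x * q ^ k i) q (n i))
    with (qpoch x q (k i) * / qpoch x q (k i + n i)); [apply bound_ratio|].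
  rewrite qpoch_add. field.
  split; apply q_regular_qpoch; [now apply q_regular_shift|exact x_reg].
Qed.

(** * The very-well-poised 6phi5 sum *)

(* [vwp_term] below is [1 - a] times the summand of
   [6phi5(a, q a^(1/2), -q a^(1/2), b, c, d; q, aq/(bcd))], parametrized by [B = aq/b]
   instead of [b] so that [a = b = 0] is not excluded. *)
Definition wp_coef (q a B c d : C) (n : nat) : C :=
  qpochs [a; a * q / B; c; d] q n / qpochs [q; B; a * q / c; a * q / d] q n.

Definition vwp_coef (q a B c d : C) (n : nat) : C :=
  (1 - a * (q ^ n) ^ 2) * wp_coef q a B c d n.

Definition vwp_term (q a B c d : C) (n : nat) : C :=
  vwp_coef q a B c d n * (B / (c * d)) ^ n.

Record vwp_admissible (q a B c d : C) : Prop := {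
  vwp_base_range : (0 < Cmod q < 1)%R;
  vwp_B_neq_0 : B <> 0;
  vwp_c_neq_0 : c <> 0;
  vwp_d_neq_0 : d <> 0;
  vwp_B_regular : q_regular q B;
  vwp_c_regular : q_regular q (a * q / c);
  vwp_d_regular : q_regular q (a * q / d)
}.

Arguments vwp_base_range {q a B c d} _.
Arguments vwp_c_neq_0 {q a B c d} _.
Arguments vwp_d_neq_0 {q a B c d} _.

Lemma vwp_admissible_q_neq_0 (q a B c d : C) : vwp_admissible q a B c d -> q <> 0.
Proof. intro adm. apply Cmod_gt_0, (vwp_base_range adm). Qed.

Lemma vwp_admissible_shift (q a B c d : C) (k : nat) :
  vwp_admissible q a B c d -> vwp_admissible q (a * q ^ k) (B * q ^ k) c d.
Proof.
intros [q_range B_neq_0 c_neq_0 d_neq_0 B_reg c_reg d_reg].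
assert (q_neq_0 : q <> 0) by apply Cmod_gt_0, q_range.
split; try assumption.
- apply Cmult_neq_0; [exact B_neq_0|now apply Cpow_nz].
- now apply q_regular_shift.
- replace (a * q ^ k * q / c) with (a * q / c * q ^ k) by (field; exact c_neq_0).
  now apply q_regular_shift.
- replace (a * q ^ k * q / d) with (a * q / d * q ^ k) by (field; exact d_neq_0).
  now apply q_regular_shift.
Qed.

Lemma wp_coef_scale (q a B c d r : C) (n : nat) :
  B <> 0 -> c <> 0 -> d <> 0 -> r <> 0 ->
  wp_coef q (a * r) (B * r) c d n
  = qpochs [a * r; a * q / B; c; d] q n
    / qpochs [q; B * r; a * q / c * r; a * q / d * r] q n.
Proof.
intros B_neq_0 c_neq_0 d_neq_0 r_neq_0. unfold wp_coef.
replace (a * r * q / (B * r)) with (a * q / B) by (field; auto).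
replace (a * r * q / c) with (a * q / c * r) by (field; auto).
now replace (a * r * q / d) with (a * q / d * r) by (field; auto).
Qed.

Lemma Cbounded_wp_coef {I : Type} (q a B c d : C) (k n : I -> nat) :
  vwp_admissible q a B c d ->
  Cbounded (fun i => wp_coef q (a * q ^ k i) (B * q ^ k i) c d (n i)).
Proof.
intros [q_range B_neq_0 c_neq_0 d_neq_0 B_reg c_reg d_reg].
assert (q_lt_1 := proj2 q_range).
assert (q_neq_0 : q <> 0) by apply Cmod_gt_0, q_range.
assert (q_reg := q_regular_small q q q_lt_1 q_lt_1).
destruct (Cbounded_mult
  (fun i => qpochs [a * q ^ k i; a * q / B; c; d] q (n i))
  (fun i => / qpoch q q (n i) * (/ qpoch (B * q ^ k i) q (n i)
    * (/ qpoch (a * q / c * q ^ k i) q (n i)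
    * / qpoch (a * q / d * q ^ k i) q (n i))))) as [M bound_prod].
- simpl.
  repeat apply Cbounded_mult; try apply Cbounded_qpoch;
    auto using Cbounded_const, Cbounded_mult, Cbounded_pow, Rlt_le.
- repeat apply Cbounded_mult;
    auto using Cbounded_inv_qpoch, Cbounded_inv_qpoch_shift.
- exists M. intro i. apply Rle_trans with (2 := bound_prod i). right. f_equal.
  rewrite wp_coef_scale by auto using Cpow_nz.
  simpl. field. repeat split; apply q_regular_qpoch; auto using q_regular_shift.
Qed.

Lemma Cbounded_vwp_coef {I : Type} (q a B c d : C) (k n : I -> nat) :
  vwp_admissible q a B c d ->
  Cbounded (fun i => vwp_coef q (a * q ^ k i) (B * q ^ k i) c d (n i)).
Proof.
intro adm. assert (q_le_1 := Rlt_le _ _ (proj2 (vwp_base_range adm))).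
apply Cbounded_mult; [|now apply Cbounded_wp_coef]. simpl.
apply Cbounded_minus; repeat apply Cbounded_mult;
  auto using Cbounded_const, Cbounded_pow.
Qed.

Lemma vwp_term_bound (q a B c d : C) : vwp_admissible q a B c d ->
  exists K, forall k n, (Cmod (vwp_term q (a * q ^ k) (B * q ^ k) c d n)
    <= K * (Cmod (B / (c * d)) * Cmod q ^ k) ^ n)%R.
Proof.
intro adm.
destruct (Cbounded_vwp_coef q a B c d fst snd adm) as [K bound_coef].
exists K. intros k n. unfold vwp_term.
replace (B * q ^ k / (c * d)) with (B / (c * d) * q ^ k)
  by (field; destruct adm; auto).
rewrite Cmod_mult, Cmod_pow, Cmod_mult, Cmod_pow.
apply Rmult_le_compat_r; [|apply (bound_coef (k, n))].
apply pow_le, Rmult_le_pos; [|apply pow_le]; apply Cmod_ge_0.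
Qed.

Lemma wp_coef_succ (q a B c d : C) (n : nat) : vwp_admissible q a B c d ->
  wp_coef q a B c d (S n)
  * ((1 - q * q ^ n) * ((1 - B * q ^ n)
     * (1 - a * q / c * q ^ n) * (1 - a * q / d * q ^ n)))
  = (1 - a * q ^ n) * (1 - a * q / B * q ^ n) * (1 - c * q ^ n) * (1 - d * q ^ n)
    * wp_coef q a B c d n.
Proof.
intros [q_range _ _ _ B_reg c_reg d_reg].
assert (q_reg := q_regular_small q q (proj2 q_range) (proj2 q_range)).
unfold wp_coef, qpochs, fold_right.
generalize (a * q / B). intro b.
generalize dependent (a * q / c). intros c' c_reg.
generalize dependent (a * q / d). intros d' d_reg.
simpl qpoch. field.
repeat split; try (apply q_regular_qpoch; assumption); auto.
Qed.

Lemma wp_coef_shift (q a B c d : C) (n : nat) : vwp_admissible q a B c d ->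
  (1 - a) * wp_coef q (a * q) (B * q) c d n
  * ((1 - B * q ^ n) * (1 - a * q / c * q ^ n) * (1 - a * q / d * q ^ n))
  = (1 - B) * (1 - a * q / c) * (1 - a * q / d) * (1 - a * q ^ n)
    * wp_coef q a B c d n.
Proof.
intros [q_range B_neq_0 c_neq_0 d_neq_0 B_reg c_reg d_reg].
assert (q_neq_0 : q <> 0) by apply Cmod_gt_0, q_range.
assert (q_reg := q_regular_small q q (proj2 q_range) (proj2 q_range)).
rewrite wp_coef_scale by assumption. unfold wp_coef, qpochs, fold_right.
generalize (a * q / B). intro b.
generalize dependent (a * q / c). intros c' c_reg.
generalize dependent (a * q / d). intros d' d_reg.
assert (shift_a := qpoch_succ_l a q n). simpl in shift_a.
rewrite (qpoch_shift_1 B), (qpoch_shift_1 c'), (qpoch_shift_1 d')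
  by now apply (q_regular_neq_1 q).
transitivity (((1 - a) * qpoch (a * q) q n) * (qpoch b q n * qpoch c q n * qpoch d q n)
  * (1 - B) * (1 - c') * (1 - d')
  / (qpoch q q n * qpoch B q n * qpoch c' q n * qpoch d' q n)).
- field. repeat split; try (apply q_regular_qpoch; assumption); auto;
    now apply (q_regular_neq_1 q).
- rewrite <- shift_a. field.
  repeat split; try (apply q_regular_qpoch; assumption).
Qed.

(* The rational identity behind the WZ pair, with [x = q^n]. *)
Lemma wz_certificate (q a B c d x : C) : B <> 0 -> c <> 0 -> d <> 0 ->
  let z := B / (c * d) in
  let den := (1 - B * x) * (1 - a * q / c * x) * (1 - a * q / d * x) in
  (1 - z) * (1 - a * x ^ 2) * den
  - (1 - B / c) * (1 - B / d) * (1 - a * q / (c * d)) * (1 - a * q * x ^ 2)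
    * (1 - a * x) * x
  = (a * z * (q * x) - 1) * z
    * ((1 - a * x) * (1 - a * q / B * x) * (1 - c * x) * (1 - d * x))
    - (1 - x) * (a * z * x - 1) * den.
Proof. intros B_neq_0 c_neq_0 d_neq_0 z den. unfold z, den. field. auto. Qed.

Definition wz_mate (q a B c d : C) (n : nat) : C :=
  (1 - q ^ n) * (a * (B / (c * d)) * q ^ n - 1) * wp_coef q a B c d n
  * (B / (c * d)) ^ n.

Lemma vwp_term_telescope (q a B c d : C) (n : nat) : vwp_admissible q a B c d ->
  let den := (1 - B) * (1 - a * q / c) * (1 - a * q / d) in
  den * (1 - B / (c * d)) * vwp_term q a B c d n
  - (1 - a) * (1 - B / c) * (1 - B / d) * (1 - a * q / (c * d))
    * vwp_term q (a * q) (B * q) c d n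
  = den * (wz_mate q a B c d (S n) - wz_mate q a B c d n).
Proof.
intros adm den.
assert (succ := wp_coef_succ q a B c d n adm).
assert (shift := wp_coef_shift q a B c d n adm).
destruct adm as [_ B_neq_0 c_neq_0 d_neq_0 B_reg c_reg d_reg].
assert (cert := wz_certificate q a B c d (q ^ n) B_neq_0 c_neq_0 d_neq_0).
unfold vwp_term, vwp_coef, wz_mate. rewrite !(Cpow_S _ n).
replace (B * q / (c * d)) with (B / (c * d) * q) by (field; auto).
rewrite Cpow_mult_l. cbv zeta in cert.
set (z := B / (c * d)) in *.
set (D := (1 - B * q ^ n) * (1 - a * q / c * q ^ n) * (1 - a * q / d * q ^ n)) in *.
assert (D_neq_0 : D <> 0) by (repeat apply Cmult_neq_0; auto).
transitivity (den * ((1 - z) * (1 - a * (q ^ n) ^ 2) * D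
    - (1 - B / c) * (1 - B / d) * (1 - a * q / (c * d))
      * (1 - a * q * (q ^ n) ^ 2) * (1 - a * q ^ n) * q ^ n)
  * wp_coef q a B c d n * z ^ n / D).
- transitivity (den * (1 - z) * ((1 - a * (q ^ n) ^ 2) * wp_coef q a B c d n * z ^ n)
    - (1 - B / c) * (1 - B / d) * (1 - a * q / (c * d)) * (1 - a * q * (q ^ n) ^ 2)
      * ((1 - a) * wp_coef q (a * q) (B * q) c d n * D) * (z ^ n * q ^ n) / D).
  + field. auto.
  + rewrite shift. fold den. field. auto.
- rewrite cert.
  transitivity (den * ((a * z * (q * q ^ n) - 1) * z
      * (wp_coef q a B c d (S n) * ((1 - q * q ^ n) * D))
    - (1 - q ^ n) * (a * z * q ^ n - 1) * D * wp_coef q a B c d n) * z ^ n / D).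
  + rewrite succ. field. auto.
  + field. auto.
Qed.

Lemma Clim_wz_mate (q a B c d : C) : vwp_admissible q a B c d ->
  (Cmod (B / (c * d)) < 1)%R -> Clim (wz_mate q a B c d) 0.
Proof.
intros adm z_lt_1. assert (q_le_1 := Rlt_le _ _ (proj2 (vwp_base_range adm))).
apply Clim_bounded_mul_pow; [|exact z_lt_1].
apply Cbounded_mult.
- apply Cbounded_mult; apply Cbounded_minus;
    auto using Cbounded_const, Cbounded_mult, Cbounded_pow.
- destruct (Cbounded_wp_coef q a B c d (fun _ => O) (fun n => n) adm) as [M bound_wp].
  exists M. intro n. specialize (bound_wp n). simpl in bound_wp.
  now rewrite !Cmult_1_r in bound_wp.
Qed.

Lemma vwp_series_shift (q a B c d s s' : C) : vwp_admissible q a B c d ->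
  (Cmod (B / (c * d)) < 1)%R ->
  is_Cseries (vwp_term q a B c d) s ->
  is_Cseries (vwp_term q (a * q) (B * q) c d) s' ->
  (1 - B) * (1 - a * q / c) * (1 - a * q / d) * (1 - B / (c * d)) * s
  = (1 - a) * (1 - B / c) * (1 - B / d) * (1 - a * q / (c * d)) * s'.
Proof.
intros adm z_lt_1 sum_s sum_s'.
set (den := (1 - B) * (1 - a * q / c) * (1 - a * q / d)).
set (num := (1 - a) * (1 - B / c) * (1 - B / d) * (1 - a * q / (c * d))).
assert (mate_lim := Clim_wz_mate q a B c d adm z_lt_1).
assert (telescoped := is_series_scal (K := C_AbsRing) (V := C_NormedModule) den _ _
  (@is_series_telescope C_AbsRing C_NormedModule _ _ mate_lim)).
assert (combined : is_Cseries (fun n => den * (1 - B / (c * d)) * vwp_term q a B c d n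
    - num * vwp_term q (a * q) (B * q) c d n)
  (den * (1 - B / (c * d)) * s - num * s')).
{ apply (@is_series_minus C_AbsRing C_NormedModule);
    now apply (@is_series_scal C_AbsRing C_NormedModule). }
assert (limits_eq : den * (1 - B / (c * d)) * s - num * s'
  = den * (0 - wz_mate q a B c d 0)).
{ apply (Clim_unique _ _ _ combined).
  eapply filterlim_ext; [|exact telescoped].
  intro n. apply sum_n_ext. intro m. symmetry. now apply vwp_term_telescope. }
replace (wz_mate q a B c d 0) with (RtoC 0) in limits_eq
  by (unfold wz_mate; simpl; ring).
rewrite <- (Cplus_0_r (num * s')).
replace (RtoC 0) with (den * (0 - 0)) by ring.
rewrite <- limits_eq. ring.
Qed.

Lemma vwp_series_lim (q a B c d : C) (s : nat -> C) : vwp_admissible q a B c d ->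
  (Cmod (B / (c * d)) < 1)%R ->
  (forall k, is_Cseries (vwp_term q (a * q ^ k) (B * q ^ k) c d) (s k)) ->
  Clim s 1.
Proof.
intros adm z_lt_1 sum_s.
destruct (vwp_term_bound q a B c d adm) as [K bound_term].
destruct (vwp_base_range adm) as [q_gt_0 q_lt_1].
apply (Clim_series_head (fun k => vwp_term q (a * q ^ k) (B * q ^ k) c d) s 1
  K (Cmod (B / (c * d))) (Cmod q)).
- split; [apply Cmod_ge_0|exact z_lt_1].
- split; [apply Cmod_ge_0|exact q_lt_1].
- exact bound_term.
- exact sum_s.
- apply Clim_iff_Cmod_minus.
  apply (is_lim_seq_ext (fun k => Cmod a * Cmod q ^ k)%R).
  + intro k. rewrite <- Cmod_pow, <- Cmod_mult, <- Cmod_opp. f_equal.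
    unfold vwp_term, vwp_coef, wp_coef. simpl. field.
  + apply is_lim_seq_scal_geom. split; [apply Cmod_ge_0|exact q_lt_1].
Qed.

Definition vwp_num (q a B c d : C) : list C := [a; B / c; B / d; a * q / (c * d)].

Definition vwp_den (q a B c d : C) : list C :=
  [B; a * q / c; a * q / d; B / (c * d)].

Lemma vwp_series_iter (q a B c d : C) (s : nat -> C) (k : nat) :
  vwp_admissible q a B c d -> (Cmod (B / (c * d)) < 1)%R ->
  (forall m, is_Cseries (vwp_term q (a * q ^ m) (B * q ^ m) c d) (s m)) ->
  qpochs (vwp_den q a B c d) q k * s O
  = qpochs (vwp_num q a B c d) q k * s k.
Proof.
intros adm z_lt_1 sum_s.
assert (q_range := vwp_base_range adm).
assert (c_neq_0 := vwp_c_neq_0 adm).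
assert (d_neq_0 := vwp_d_neq_0 adm).
induction k as [|k IH]; [simpl; ring|].
assert (z_k_lt_1 : (Cmod (B * q ^ k / (c * d)) < 1)%R).
{ replace (B * q ^ k / (c * d)) with (B / (c * d) * q ^ k) by (field; auto).
  rewrite Cmod_mult, Cmod_pow.
  generalize (pow_unit_interval (Cmod q) k ltac:(lra)) (Cmod_ge_0 (B / (c * d))).
  nra. }
assert (sum_s_k := sum_s (S k)).
replace (a * q ^ S k) with (a * q ^ k * q) in sum_s_k by (rewrite Cpow_S; ring).
replace (B * q ^ S k) with (B * q ^ k * q) in sum_s_k by (rewrite Cpow_S; ring).
assert (shift := vwp_series_shift q _ _ c d _ _
  (vwp_admissible_shift q a B c d k adm) z_k_lt_1 (sum_s k) sum_s_k).
transitivity (qpochs (vwp_den q a B c d) q k * s O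
  * ((1 - B * q ^ k) * (1 - a * q ^ k * q / c) * (1 - a * q ^ k * q / d)
     * (1 - B * q ^ k / (c * d)))).
- simpl. field. auto.
- rewrite IH.
  transitivity (qpochs (vwp_num q a B c d) q k
    * ((1 - B * q ^ k) * (1 - a * q ^ k * q / c) * (1 - a * q ^ k * q / d)
       * (1 - B * q ^ k / (c * d)) * s k)); [ring|].
  rewrite shift. simpl. field. auto.
Qed.

Theorem vwp_6phi5_sum (q a B c d : C) : vwp_admissible q a B c d ->
  (Cmod (B / (c * d)) < 1)%R ->
  is_Cseries (vwp_term q a B c d)
    (qpochs_inf (vwp_num q a B c d) q / qpochs_inf (vwp_den q a B c d) q).
Proof.
intros adm z_lt_1.
set (s := fun k => Cseries (vwp_term q (a * q ^ k) (B * q ^ k) c d)).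
assert (q_range := vwp_base_range adm).
assert (sum_s : forall k, is_Cseries (vwp_term q (a * q ^ k) (B * q ^ k) c d) (s k)).
{ intro k. apply Cseries_correct.
  destruct (vwp_term_bound q a B c d adm) as [K bound_term].
  apply (@ex_series_le C_AbsRing C_CompleteNormedModule _ _ (bound_term k)).
  eexists. apply is_series_scal_geom.
  assert (q_k := pow_unit_interval (Cmod q) k ltac:(lra)).
  generalize (Cmod_ge_0 (B / (c * d))). nra. }
assert (iter_lim : qpochs_inf (vwp_den q a B c d) q * s O
  = qpochs_inf (vwp_num q a B c d) q * 1).
{ apply (Clim_unique
    (fun k => qpochs (vwp_den q a B c d) q k * s O)).
  - apply (Clim_mult (qpochs _ q) (fun _ => s O));
      [now apply qpochs_inf_correct|apply filterlim_const].
  - eapply filterlim_ext; [intro k; symmetry; now apply vwp_series_iter|].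
    apply Clim_mult; [now apply qpochs_inf_correct|].
    now apply (vwp_series_lim q a B c d). }
replace (_ / _) with (s O).
- generalize (sum_s O). now rewrite !Cmult_1_r.
- rewrite <- (Cmult_1_r (qpochs_inf (vwp_num _ _ _ _ _) q)), <- iter_lim.
  field. apply qpochs_inf_neq_0; [apply q_range|].
  destruct adm. repeat constructor; auto using q_regular_small.
  now apply q_regular_small.
Qed.

(** * A contiguous 6phi5 sum *)

Lemma wp_coef_succ_shift (q a B c d : C) (n : nat) : vwp_admissible q a B c d ->
  (1 - q * q ^ n) * (1 - a * q * q ^ n) * wp_coef q a B c d (S n)
  * ((1 - B) * (1 - a * q / c) * (1 - a * q / d))
  = (1 - a) * (1 - a * q) * (1 - a * q / B) * (1 - c) * (1 - d)
    * wp_coef q (a * q ^ 2) (B * q) (c * q) (d * q) n.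
Proof.
intros [q_range B_neq_0 c_neq_0 d_neq_0 B_reg c_reg d_reg].
assert (q_neq_0 : q <> 0) by apply Cmod_gt_0, q_range.
assert (q_reg := q_regular_small q q (proj2 q_range) (proj2 q_range)).
unfold wp_coef, qpochs, fold_right.
replace (a * q ^ 2 * q / (B * q)) with (a * q / B * q) by (field; auto).
replace (a * q ^ 2 * q / (c * q)) with (a * q / c * q) by (field; auto).
replace (a * q ^ 2 * q / (d * q)) with (a * q / d * q) by (field; auto).
generalize (a * q / B). intro b.
generalize dependent (a * q / c). intros c' c_reg.
generalize dependent (a * q / d). intros d' d_reg.
assert (shift_a : (1 - a) * (1 - a * q) * qpoch (a * q ^ 2) q n
  = qpoch a q (S n) * (1 - a * q * q ^ n)).
{ transitivity (qpoch a q (2 + n)); [rewrite qpoch_add|]; simpl; ring. }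
rewrite (qpoch_succ_l b), (qpoch_succ_l c), (qpoch_succ_l d), (qpoch_succ_l B),
  (qpoch_succ_l c'), (qpoch_succ_l d').
change (qpoch q q (S n)) with (qpoch q q n * (1 - q * q ^ n)).
assert (head_neq_0 : forall y, q_regular q y -> 1 - y <> 0)
  by (intro y; apply q_regular_neq_1).
assert (shift_neq_0 : forall y, q_regular q y -> qpoch (y * q) q n <> 0).
{ intros y y_reg. now apply q_regular_qpoch, q_regular_shift_1. }
assert (q_n_neq_0 := proj1 (q_regular_qpoch q q) q_reg n).
specialize (q_reg n).
transitivity (qpoch a q (S n) * (1 - a * q * q ^ n)
  * ((1 - b) * qpoch (b * q) q n * ((1 - c) * qpoch (c * q) q n)
     * ((1 - d) * qpoch (d * q) q n))
  / (qpoch q q n * qpoch (B * q) q n * qpoch (c' * q) q n * qpoch (d' * q) q n)).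
- field. repeat split; auto.
- rewrite <- shift_a. field. repeat split; auto.
Qed.

Lemma vwp_admissible_contiguous (q a B c d : C) : vwp_admissible q a B c d ->
  vwp_admissible q (a * q ^ 2) (B * q) (c * q) (d * q).
Proof.
intros [q_range B_neq_0 c_neq_0 d_neq_0 B_reg c_reg d_reg].
assert (q_neq_0 : q <> 0) by apply Cmod_gt_0, q_range.
split; auto using Cmult_neq_0, q_regular_shift_1.
- replace (a * q ^ 2 * q / (c * q)) with (a * q / c * q) by (field; auto).
  now apply q_regular_shift_1.
- replace (a * q ^ 2 * q / (d * q)) with (a * q / d * q) by (field; auto).
  now apply q_regular_shift_1.
Qed.

Definition contiguous_factor (q a B c d : C) : C :=
  B / (c * d * q) * (1 - a) * (1 - a * q) * (1 - a * q / B) * (1 - c) * (1 - d)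
  / ((1 - B) * (1 - a * q / c) * (1 - a * q / d)).

Definition contiguous_term (q a B c d : C) (n : nat) : C :=
  (1 + a * (q ^ n) ^ 2) * vwp_coef q a B c d n * (B / (c * d * q)) ^ n.

(* With [x = q^n], this is the splitting [1 + a x^2 = (1 + a) x + (1 - x)(1 - a x)]:
   [x] turns the power of [B/(cdq)] into that of [B/(cd)], and the factor
   [(1 - x)(1 - a x)] shifts all the parameters. *)
Lemma contiguous_term_split (q a B c d : C) (n : nat) : vwp_admissible q a B c d ->
  contiguous_term q a B c d (S n)
  = (1 + a) * vwp_term q a B c d (S n)
    + contiguous_factor q a B c d
      * vwp_term q (a * q ^ 2) (B * q) (c * q) (d * q) n.
Proof.
intro adm.
assert (shift := wp_coef_succ_shift q a B c d n adm).
destruct adm as [q_range B_neq_0 c_neq_0 d_neq_0 B_reg c_reg d_reg].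
assert (q_neq_0 : q <> 0) by apply Cmod_gt_0, q_range.
unfold contiguous_term, vwp_term, vwp_coef, contiguous_factor.
set (w := B / (c * d * q)).
replace (B / (c * d)) with (w * q) by (unfold w; field; auto).
replace (B * q / (c * q * (d * q))) with w by (unfold w; field; auto).
rewrite Cpow_mult_l, !(Cpow_S _ n).
set (den := (1 - B) * (1 - a * q / c) * (1 - a * q / d)) in *.
assert (den_neq_0 : den <> 0)
  by (repeat apply Cmult_neq_0; now apply (q_regular_neq_1 q)).
transitivity ((1 + a) * ((1 - a * (q * q ^ n) ^ 2) * wp_coef q a B c d (S n)
    * (w * w ^ n * (q * q ^ n)))
  + w * (1 - a * (q * q ^ n) ^ 2) * w ^ n
    * ((1 - q * q ^ n) * (1 - a * q * q ^ n) * wp_coef q a B c d (S n) * den)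
    / den).
- field. auto.
- rewrite shift. field. auto.
Qed.

Lemma contiguous_sum_value (q a B c d : C) : vwp_admissible q a B c d ->
  let w := B / (c * d * q) in
  (Cmod w < 1)%R ->
  (1 + a) * (qpochs_inf (vwp_num q a B c d) q / qpochs_inf (vwp_den q a B c d) q)
  + contiguous_factor q a B c d
    * (qpochs_inf (vwp_num q (a * q ^ 2) (B * q) (c * q) (d * q)) q
       / qpochs_inf (vwp_den q (a * q ^ 2) (B * q) (c * q) (d * q)) q)
  = qpochs_inf (vwp_num q a B c d) q / qpochs_inf [B; a * q / c; a * q / d; w] q
    * ((1 + a) * (1 - w) + w * (1 - a * q / B) * (1 - c) * (1 - d)).
Proof.
intros [q_range B_neq_0 c_neq_0 d_neq_0 B_reg c_reg d_reg] w w_lt_1.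
assert (q_lt_1 := proj2 q_range).
assert (q_neq_0 : q <> 0) by apply Cmod_gt_0, q_range.
assert (w_reg := q_regular_small q w q_lt_1 w_lt_1).
unfold vwp_num, vwp_den, contiguous_factor, qpochs_inf, fold_right. fold w.
replace (B / (c * d)) with (w * q) by (unfold w; field; auto).
replace (B * q / (c * q * (d * q))) with w by (unfold w; field; auto).
replace (B * q / (c * q)) with (B / c) by (field; auto).
replace (B * q / (d * q)) with (B / d) by (field; auto).
replace (a * q ^ 2 * q / (c * q)) with (a * q / c * q) by (field; auto).
replace (a * q ^ 2 * q / (d * q)) with (a * q / d * q) by (field; auto).
replace (a * q ^ 2 * q / (c * q * (d * q))) with (a * q / (c * d)) by (field; auto).
replace (a * q ^ 2) with (a * q * q) by ring.
generalize (a * q / B) (a * q / (c * d)) (B / c) (B / d). intros b cd' Bc Bd.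
generalize dependent (a * q / c). intros c' c_reg.
generalize dependent (a * q / d). intros d' d_reg.
generalize dependent w. intros w w_lt_1 w_reg.
rewrite (qpoch_inf_succ a), (qpoch_inf_succ (a * q)), (qpoch_inf_succ B),
  (qpoch_inf_succ c'), (qpoch_inf_succ d'), (qpoch_inf_succ w) by exact q_lt_1.
assert (inf_neq_0 : forall y, q_regular q y -> 1 - y <> 0 /\ qpoch_inf (y * q) q <> 0).
{ intros y y_reg. split; [now apply (q_regular_neq_1 q)|].
  now apply qpoch_inf_neq_0, q_regular_shift_1. }
destruct (inf_neq_0 B B_reg), (inf_neq_0 c' c_reg), (inf_neq_0 d' d_reg),
  (inf_neq_0 w w_reg).
field. repeat split; assumption.
Qed.

Lemma contiguous_rest_sum (q a B c d : C) : vwp_admissible q a B c d ->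
  (Cmod (B / (c * d * q)) < 1)%R ->
  is_Cseries (fun n => contiguous_term q a B c d n - (1 + a) * vwp_term q a B c d n)
    (contiguous_factor q a B c d
     * (qpochs_inf (vwp_num q (a * q ^ 2) (B * q) (c * q) (d * q)) q
        / qpochs_inf (vwp_den q (a * q ^ 2) (B * q) (c * q) (d * q)) q)).
Proof.
intros adm w_lt_1.
assert (q_neq_0 := vwp_admissible_q_neq_0 q a B c d adm).
set (rest := fun n => contiguous_term q a B c d n - (1 + a) * vwp_term q a B c d n).
assert (minus_rest_0 : forall l : C, plus l (opp (rest O)) = l).
{ intro l. unfold rest, contiguous_term, vwp_term, vwp_coef, wp_coef. simpl.
  change plus with Cplus. change opp with Copp. field. }
assert (rest_succ : forall n, contiguous_factor q a B c d
  * vwp_term q (a * q ^ 2) (B * q) (c * q) (d * q) n = rest (S n)).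
{ intro n. unfold rest. rewrite contiguous_term_split by exact adm. ring. }
apply (@is_series_decr_1 C_AbsRing C_NormedModule). rewrite minus_rest_0.
apply (is_series_ext _ _ _ rest_succ).
apply (@is_series_scal C_AbsRing C_NormedModule), vwp_6phi5_sum.
- now apply vwp_admissible_contiguous.
- replace (B * q / (c * q * (d * q))) with (B / (c * d * q)); [exact w_lt_1|].
  field. destruct adm; auto.
Qed.

Theorem contiguous_vwp_6phi5_sum (q a B c d : C) : vwp_admissible q a B c d ->
  let w := B / (c * d * q) in
  (Cmod w < 1)%R ->
  is_Cseries (contiguous_term q a B c d)
    (qpochs_inf (vwp_num q a B c d) q / qpochs_inf [B; a * q / c; a * q / d; w] q
     * ((1 + a) * (1 - w) + w * (1 - a * q / B) * (1 - c) * (1 - d))).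
Proof.
intros adm w w_lt_1. unfold w. rewrite <- contiguous_sum_value by assumption.
assert (recombine : forall n, (1 + a) * vwp_term q a B c d n
    + (contiguous_term q a B c d n - (1 + a) * vwp_term q a B c d n)
  = contiguous_term q a B c d n) by (intro n; ring).
apply (is_series_ext _ _ _ recombine).
apply (@is_series_plus C_AbsRing C_NormedModule); [|now apply contiguous_rest_sum].
apply (@is_series_scal C_AbsRing C_NormedModule), vwp_6phi5_sum; [exact adm|].
assert (q_neq_0 := vwp_admissible_q_neq_0 q a B c d adm).
replace (B / (c * d)) with (w * q) by (unfold w; field; destruct adm; auto).
rewrite Cmod_mult. generalize (vwp_base_range adm) (Cmod_ge_0 w). nra.
Qed.

(** * The quadratic sum *)

Lemma qpoch_sqr (x q : C) (n : nat) :
  qpoch (x ^ 2) (q ^ 2) n = qpoch x q n * qpoch (- x) q n.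
Proof.
induction n as [|n IH]; [simpl; ring|].
change (qpoch (x ^ 2) (q ^ 2) n * (1 - x ^ 2 * (q ^ 2) ^ n)
  = qpoch x q n * (1 - x * q ^ n) * (qpoch (- x) q n * (1 - - x * q ^ n))).
rewrite IH, <- Cpow_mult_r, Nat.mul_comm, Cpow_mult_r. ring.
Qed.

Lemma quadratic_admissible (q a s t : C) :
  (0 < Cmod q < 1)%R -> s <> 0 -> t <> 0 ->
  (forall n, qpochs [a * q / s; a * q / t] q n <> 0) ->
  vwp_admissible q a (- q) s t.
Proof.
intros q_range s_neq_0 t_neq_0 den_neq_0.
split; try assumption.
- apply Cmod_gt_0. rewrite Cmod_opp. apply q_range.
- apply q_regular_small; rewrite ?Cmod_opp; apply q_range.
- apply (q_regular_qpochs q _ _ den_neq_0). simpl. auto.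
- apply (q_regular_qpochs q _ _ den_neq_0). simpl. auto.
Qed.

Lemma quadratic_summand (q a s t : C) (n : nat) :
  vwp_admissible q a (- q) s t ->
  q_regular (q ^ 2) a -> q_regular (q ^ 2) (- a) ->
  qpochs [a ^ 2; a * q ^ 2; - (a * q ^ 2)] (q ^ 2) n * qpochs [s; t] q n
  / (qpochs [q ^ 2; a; - a] (q ^ 2) n * qpochs [a * q / s; a * q / t] q n)
  * (- (1 / (s * t))) ^ n
  = / ((1 - a) * (1 - - a)) * contiguous_term q a (- q) s t n.
Proof.
intros adm a_reg ma_reg.
assert (q_neq_0 := vwp_admissible_q_neq_0 _ _ _ _ _ adm).
destruct adm as [q_range _ s_neq_0 t_neq_0 mq_reg s_reg t_reg].
assert (a_neq_1 := q_regular_neq_1 _ _ a_reg).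
assert (ma_neq_1 := q_regular_neq_1 _ _ ma_reg).
assert (q_reg := q_regular_small q q (proj2 q_range) (proj2 q_range)).
assert (neq_0 : forall p y, q_regular p y -> qpoch y p n <> 0)
  by (intros p y y_reg; now apply q_regular_qpoch).
unfold contiguous_term, vwp_coef, wp_coef, qpochs, fold_right.
replace (- q / (s * t * q)) with (- (1 / (s * t))) by (field; auto).
replace (a * q / - q) with (- a) by (field; exact q_neq_0).
replace (- (a * q ^ 2)) with (- a * q ^ 2) by ring.
rewrite !qpoch_sqr, !qpoch_shift_1 by assumption.
rewrite <- Cpow_mult_r, Nat.mul_comm, Cpow_mult_r.
generalize dependent (a * q / s). intros s' s_reg.
generalize dependent (a * q / t). intros t' t_reg.
generalize ((- (1 / (s * t))) ^ n). intro w_n.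
field. repeat split; auto.
Qed.

Lemma quadratic_sum_value (q a s t : C) :
  vwp_admissible q a (- q) s t -> 1 - a <> 0 -> 1 - - a <> 0 ->
  let w := - (1 / (s * t)) in
  (Cmod w < 1)%R ->
  / ((1 - a) * (1 - - a))
  * (qpochs_inf (vwp_num q a (- q) s t) q
     / qpochs_inf [- q; a * q / s; a * q / t; w] q
     * ((1 + a) * (1 - w) + w * (1 - a * q / - q) * (1 - s) * (1 - t)))
  = (s + t) / (s * t)
    * (qpochs_inf [a * q; - (q / s); - (q / t); a * q / (s * t)] q
       / qpochs_inf [- q; a * q / s; a * q / t; w] q).
Proof.
intros adm a_neq_1 ma_neq_1 w w_lt_1.
assert (q_neq_0 := vwp_admissible_q_neq_0 _ _ _ _ _ adm).
destruct adm as [[_ q_lt_1] _ s_neq_0 t_neq_0 mq_reg s_reg t_reg].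
assert (den_neq_0 : qpochs_inf [- q; a * q / s; a * q / t; w] q <> 0).
{ apply qpochs_inf_neq_0; [exact q_lt_1|].
  repeat constructor; try assumption. now apply q_regular_small. }
replace (qpochs_inf (vwp_num q a (- q) s t) q) with
  ((1 - a) * qpochs_inf [a * q; - (q / s); - (q / t); a * q / (s * t)] q).
- generalize dependent (qpochs_inf [- q; a * q / s; a * q / t; w] q).
  intros den den_neq_0.
  generalize (qpochs_inf [a * q; - (q / s); - (q / t); a * q / (s * t)] q).
  intro num. unfold w. field. repeat split; auto.
- unfold vwp_num, qpochs_inf, fold_right. rewrite (qpoch_inf_succ a) by exact q_lt_1.
  replace (- q / s) with (- (q / s)) by (field; exact s_neq_0).
  replace (- q / t) with (- (q / t)) by (field; exact t_neq_0). ring.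
Qed.

Theorem theorem1p1 (q a s t : C)
  (hq : (0 < Cmod q < 1)%R)
  (hs : s <> 0) (ht : t <> 0)
  (hst : (Cmod (1 / (s * t)) < 1)%R)
  (hden : forall n : nat,
     qpochs [q ^ 2; a; - a] (q ^ 2) n * qpochs [a * q / s; a * q / t] q n <> 0)
  (hden_inf :
     qpochs_inf [- q; a * q / s; a * q / t; - (1 / (s * t))] q <> 0) :
  @is_series C_AbsRing C_NormedModule
    (fun n : nat =>
       (qpochs [a ^ 2; a * q ^ 2; - (a * q ^ 2)] (q ^ 2) n * qpochs [s; t] q n)
       / (qpochs [q ^ 2; a; - a] (q ^ 2) n * qpochs [a * q / s; a * q / t] q n)
       * (- (1 / (s * t))) ^ n)
    ((s + t) / (s * t)
     * (qpochs_inf [a * q; - (q / s); - (q / t); a * q / (s * t)] q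
        / qpochs_inf [- q; a * q / s; a * q / t; - (1 / (s * t))] q)).
Proof.
assert (sqr_den_neq_0 : forall n, qpochs [q ^ 2; a; - a] (q ^ 2) n <> 0).
{ intros n den_0. apply (hden n). rewrite den_0. ring. }
assert (a_reg := q_regular_qpochs _ a _ sqr_den_neq_0 ltac:(simpl; auto)).
assert (ma_reg := q_regular_qpochs _ (- a) _ sqr_den_neq_0 ltac:(simpl; auto)).
assert (adm : vwp_admissible q a (- q) s t).
{ apply quadratic_admissible; try assumption.
  intros n den_0. apply (hden n). rewrite den_0. ring. }
assert (w_lt_1 : (Cmod (- (1 / (s * t))) < 1)%R) by now rewrite Cmod_opp.
assert (q_neq_0 := vwp_admissible_q_neq_0 q a (- q) s t adm).
assert (sum := contiguous_vwp_6phi5_sum q a (- q) s t adm).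
replace (- q / (s * t * q)) with (- (1 / (s * t))) in sum by (field; auto).
rewrite <- quadratic_sum_value by eauto using q_regular_neq_1.
apply (is_series_ext _ _ _
  (fun n => eq_sym (quadratic_summand q a s t n adm a_reg ma_reg))).
now apply (@is_series_scal C_AbsRing C_NormedModule), sum.
Qed.
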